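(* Let $\mathscr H=\mathscr H(\Omega)$ be a functional Hilbert space on a nonempty set $\Omega$, and let $A,B,X$ be bounded linear operators on $\mathscr H$ such that $A$ and $B$ are positive. Then for all real $r\ge 2$ and $0\le\alpha\le 1$, $$\mathbf{ber}^{r}\left(\frac{A^{\alpha}XB^{1-\alpha}+A^{1-\alpha}XB^{\alpha}}{2}\right)\le\frac{\|X\|^{r}}{2}\,\mathbf{ber}(A^{r}+B^{r})\le\frac{\|X\|^{r}}{2}\Big(\mathbf{ber}\big(\alpha A^{r}+(1-\alpha)B^{r}\big)+\mathbf{ber}\big((1-\alpha)A^{r}+\alpha B^{r}\big)\Big).$$
   Context: A functional Hilbert space $\mathscr H(\Omega)$ is a complex Hilbert space of complex-valued functions on a nonempty set $\Omega$ such that for each $\lambda\in\Omega$ the evaluation $f\mapsto f(\lambda)$ is a continuous linear functional; $k_\lambda\in\mathscr H$ denotes the unique element with $f(\lambda)=\langle f,k_\lambda\rangle$ for all $f\in\mathscr H$. It is assumed that $k_\lambda\neq0$ for every $\lambda$, and $\hat k_\lambda=k_\lambda/\|k_\lambda\|$ is the normalized reproducing kernel. For a bounded linear operator $T$ on $\mathscr H$, the Berezin number is $\mathbf{ber}(T)=\sup_{\lambda\in\Omega}|\langle T\hat k_\lambda,\hat k_\lambda\rangle|$, and $\mathbf{ber}^r(T)$ means $(\mathbf{ber}(T))^r$. An operator $A$ is positive if $\langle Ax,x\rangle\ge0$ for all $x$; its real powers are defined by the continuous functional calculus, with $A^0=I$. $\|X\|$ is the operator norm. *)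

(* Defs.v *)
From mathcomp Require Import all_boot all_order all_algebra.
From mathcomp Require Import complex.
From mathcomp Require Import all_classical all_reals all_analysis.

Set Implicit Arguments.
Unset Strict Implicit.
Unset Printing Implicit Defensive.

Import Order.TTheory GRing.Theory Num.Theory.
Import numFieldNormedType.Exports.

Local Open Scope classical_set_scope.
Local Open Scope ring_scope.
Local Open Scope complex_scope.

(* A vector f of the space is identified with the function
   lam |-> fh_eval lam f, which determines it by fh_eval_inj.
   The inner product is linear in its first argument. *)
Record functional_hilbert (R : realType) (Omega : Type) := FunctionalHilbert {
  fh_space :> completeNormedModType R[i];
  fh_dot : {dot fh_space for @conjc R};
  fh_normE : forall f : fh_space, `|f| ^+ 2 = fh_dot f f;
  fh_eval : Omega -> {linear fh_space -> R[i]^o};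
  fh_eval_inj : forall f g : fh_space,
    (forall lam : Omega, fh_eval lam f = fh_eval lam g) -> f = g;
  fh_eval_continuous : forall lam : Omega, continuous (fh_eval lam)
}.

Section Operators.
Context {R : realType} {Omega : Type} {H : functional_hilbert R Omega}.
Implicit Types (A T : H -> H) (lam : Omega).

Local Notation "''[' u , v ]" := (fh_dot H u v) : ring_scope.

Definition reproducing_kernel lam : H :=
  xget 0 [set k : H | forall f : H, fh_eval H lam f = '[f, k]].

Definition normalized_kernel lam : H :=
  `|reproducing_kernel lam|^-1 *: reproducing_kernel lam.

Definition ber T : R :=
  sup [set complex.Re `|'[T (normalized_kernel lam), normalized_kernel lam]|
      | lam in [set: Omega]].

Definition bounded_operator T : Prop := linear T /\ continuous T.

(* The norm of H is R[i]-valued, with values on the nonnegative real axis. *)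
Definition op_norm T : R :=
  sup [set complex.Re `|T x| | x in [set x : H | `|x| <= 1]].

(* The order of R[i] makes 0 <= z say that z is real and nonnegative. *)
Definition positive_operator A : Prop := forall x : H, 0 <= '[A x, x].

Definition spectrum A : set R[i] :=
  [set z | ~ exists S : H -> H, [/\ bounded_operator S,
     cancel (fun x => A x - z *: x) S & cancel S (fun x => A x - z *: x)]].

Definition op_horner A (p : {poly R}) : H -> H :=
  fun x => \sum_(i < size p) (p`_i)%:C *: iter i A x.

(* Continuous functional calculus of a self-adjoint operator A and a
   real-valued f: since the spectrum of A is real, f(A) is the limit in operator
   norm of p_n(A) for real polynomials p_n converging to f uniformly on it. *)
Definition is_cfc A (f : R -> R) T : Prop :=
  bounded_operator T /\
  exists p : nat -> {poly R},
    {uniform [set t : R | spectrum A t%:C],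
      (fun n => horner (p n)) @ \oo --> f} /\
    (fun n => op_norm (op_horner A (p n) - T)) @ \oo --> (0 : R).

Definition cfc A (f : R -> R) : H -> H := xget 0 [set T | is_cfc A f T].

(* 0 `^ 0 = 1, so op_pow A 0 is the identity. *)
Definition op_pow A (s : R) : H -> H := cfc A (fun t => t `^ s).

End Operators.

(* Main.v *)
(* For a unit vector k, Cauchy-Schwarz bounds |<(A^a X B^(1-a) + A^(1-a) X B^a) k, k>|
   by ||X|| (||A^a k|| ||B^(1-a) k|| + ||A^(1-a) k|| ||B^a k||), and McCarthy's
   inequality ||A^a k|| <= <A^r k, k>^(a/r), valid for 2a <= r, reduces the first
   claim to convexity of t^r and the weighted AM-GM inequality for the two
   numbers <A^r k, k> and <B^r k, k>.  The second claim is subadditivity of ber.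

   All facts about the functional calculus come from one positivity statement: a
   real polynomial that is nonnegative on the approximate point spectrum of A has
   a nonnegative quadratic form at A.  It bounds ||p(A)|| by the supremum of |p|,
   so by Weierstrass approximation f(A) exists for f continuous on [0, M]. *)

Require Import Defs.
From HB Require Import structures.
From mathcomp Require Import all_boot all_order all_algebra.
From mathcomp Require Import complex ring lra.
From mathcomp Require Import all_classical all_reals all_analysis.
Import Order.TTheory GRing.Theory Num.Theory.
Import numFieldNormedType.Exports.
Local Open Scope classical_set_scope.
Local Open Scope ring_scope.
Local Open Scope complex_scope.

Set Implicit Arguments.
Unset Strict Implicit.
Unset Printing Implicit Defensive.

(** * Norm and inner product *)

Section HilbertSpace.
Context {R : realType} {Omega : Type} {H : functional_hilbert R Omega}.
Implicit Types (x y z : H) (T : H -> H).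

Local Notation "''[' u , v ]" := (fh_dot H u v) : ring_scope.

(** [op_pow] is chosen by [xget] among norm limits of polynomials, so no rule such as A^(2s) =
    (A^s)^2 comes with it. Each fact is therefore proved for an arbitrary [T] with [is_cfc A f T],
    by transferring a polynomial inequality up to an error [e]. In McCarthy's bound the square is
    taken on the approximating polynomial, where |p(A) k|^2 = <p(A)^2 k, k> is plain algebra.
    Positivity is tested on approximate eigenvalues for two reasons: lower bounds multiply along a
    factorization into linear factors, and these points lie in the spectrum, where [is_cfc] controls
    the approximants. That the spectrum lies in [0, M] enters only in the existence of the powers.
    Since <A^r k, k> may vanish, strictly positive upper bounds stand in for it. The hypothesis r >=
    2 gives 2a <= r for both exponents alpha and 1 - alpha. *)

Definition nrm x : R := complex.Re `|x|.

Lemma ReK (a : R[i]) : 0 <= a -> (complex.Re a)%:C = a.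
Proof. by move=> /ger0_real; exact: RRe_real. Qed.

Lemma nrmE x : `|x| = (nrm x)%:C.
Proof. by rewrite ReK. Qed.

Lemma nrm_ge0 x : 0 <= nrm x.
Proof. by rewrite -ler0c -nrmE. Qed.

Lemma nrm0 : nrm 0 = 0.
Proof. by rewrite /nrm normr0. Qed.

Lemma nrmN x : nrm (- x) = nrm x.
Proof. by rewrite /nrm normrN. Qed.

Lemma nrmB x y : nrm (x - y) = nrm (y - x).
Proof. by rewrite -nrmN opprB. Qed.

Lemma nrm_eq0 x : nrm x = 0 -> x = 0.
Proof. by move=> x0; apply/eqP; rewrite -normr_eq0 nrmE x0. Qed.

Lemma nrm_gt0 x : x != 0 -> 0 < nrm x.
Proof.
move=> x0; rewrite lt_neqAle nrm_ge0 andbT; apply: contra x0 => /eqP/esym.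
by move/nrm_eq0 => ->.
Qed.

Lemma le_nrmD x y : nrm (x + y) <= nrm x + nrm y.
Proof.
rewrite -lecR; have := ler_normD x y; rewrite !nrmE.
by rewrite -(rmorphD (real_complex R)).
Qed.

Lemma le_nrmB x y : nrm (x - y) <= nrm x + nrm y.
Proof. by rewrite -[nrm y]nrmN le_nrmD. Qed.

Lemma nrmZ (a : R[i]) x : nrm (a *: x) = complex.Re `|a| * nrm x.
Proof.
apply: complexI; rewrite -nrmE normrZ nrmE rmorphM; congr (_ * _).

Qed.

Lemma nrmZr (a : R) x : nrm (a%:C *: x) = `|a| * nrm x.
Proof. by rewrite nrmZ normc_def /= expr0n /= addr0 sqrtr_sqr. Qed.

Definition rdot x y : R := complex.Re '[x, y].

Lemma dotDl x y z : '[x + y, z] = '[x, z] + '[y, z].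
Proof. exact: linearDl. Qed.
Lemma dotDr x y z : '[z, x + y] = '[z, x] + '[z, y].
Proof. exact: linearDr. Qed.
Lemma dotBl x y z : '[x - y, z] = '[x, z] - '[y, z].
Proof. exact: linearBl. Qed.
Lemma dotBr x y z : '[z, x - y] = '[z, x] - '[z, y].
Proof. exact: linearBr. Qed.
Lemma dotZl (a : R[i]) x y : '[a *: x, y] = a * '[x, y].
Proof. exact: linearZl_LR. Qed.
Lemma dotZr (a : R[i]) x y : '[x, a *: y] = conjc a * '[x, y].
Proof. exact: linearZr_LR. Qed.
Lemma dotC x y : '[x, y] = conjc '[y, x].
Proof. by rewrite (hermC (fh_dot H)) /= expr0 mul1r. Qed.

Lemma rdotDl x y z : rdot (x + y) z = rdot x z + rdot y z.
Proof. by rewrite /rdot dotDl raddfD. Qed.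
Lemma rdotBl x y z : rdot (x - y) z = rdot x z - rdot y z.
Proof. by rewrite /rdot dotBl raddfB. Qed.
Lemma rdotBr x y z : rdot z (x - y) = rdot z x - rdot z y.
Proof. by rewrite /rdot dotBr raddfB. Qed.
Lemma rdotC x y : rdot x y = rdot y x.
Proof. by rewrite /rdot dotC; case: '[y, x]. Qed.
Lemma rdotZl (a : R) x y : rdot (a%:C *: x) y = a * rdot x y.
Proof. by rewrite /rdot dotZl; case: '[x, y] => b c /=; rewrite mul0r subr0. Qed.
Lemma rdotZr (a : R) x y : rdot x (a%:C *: y) = a * rdot x y.
Proof. by rewrite rdotC rdotZl rdotC. Qed.
Lemma rdot0l y : rdot 0 y = 0.
Proof. by rewrite -(subrr 0) rdotBl subrr. Qed.

Lemma nrm_sq x : nrm x ^+ 2 = rdot x x.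
Proof.
apply: complexI; rewrite rmorphXn /= -nrmE fh_normE /rdot ReK // -fh_normE.

Qed.

Lemma rdot_self x : '[x, x] = (nrm x ^+ 2)%:C.
Proof. by rewrite -fh_normE nrmE rmorphXn. Qed.

Lemma conjcM (a b : R[i]) : conjc (a * b) = conjc a * conjc b.
Proof. exact: (rmorphM (@conjc R)). Qed.

Lemma cauchy_schwarz x y : complex.Re `|'[x, y]| <= nrm x * nrm y.
Proof.
have [->|y0] := eqVneq y 0; first by rewrite raddf0 nrm0 mulr0 normr0.
have ny : 0 < nrm y by exact: nrm_gt0.
set a := '[x, y].
pose c := a * (nrm y ^- 2)%:C.
have := sqr_ge0 (nrm (x - c *: y)).
rewrite nrm_sq rdotBl !rdotBr -!nrm_sq nrmZ [rdot _ x]rdotC.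
have -> : rdot x (c *: y) = complex.Re `|a| ^+ 2 / nrm y ^+ 2.
  rewrite /rdot dotZr -/a /c conjcM conjc_real mulrAC [X in X * _]mulrC -sqr_normc.
  by rewrite normc_def -(rmorphXn (real_complex R)) -(rmorphM (real_complex R)).
have -> : complex.Re `|c| = complex.Re `|a| / nrm y ^+ 2.
  rewrite /c normrM (ger0_norm (_ : 0 <= (nrm y ^- 2)%:C)) ?ler0c ?invr_ge0 ?sqr_ge0//.
  by rewrite normc_def -(rmorphM (real_complex R)).
have -> : complex.Re `|a| / nrm y ^+ 2 * nrm y = complex.Re `|a| / nrm y.
  by field; rewrite gt_eqF.
rewrite expr_div_n opprB subrr addr0 subr_ge0 ler_pdivrMr ?exprn_gt0// -exprMn.
by rewrite ler_pXn2r// nnegrE ?mulr_ge0 ?nrm_ge0// normc_def /= sqrtr_ge0.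
Qed.

Lemma Re_le_norm (a : R[i]) : `|complex.Re a| <= complex.Re `|a|.
Proof. by rewrite -lecR (le_trans (normc_ge_Re a))// ReK. Qed.

Lemma rdot_le x y : rdot x y <= nrm x * nrm y.
Proof. by rewrite (le_trans _ (cauchy_schwarz x y))// (le_trans _ (Re_le_norm _))// ler_norm. Qed.

Lemma abs_rdot_le x y : `|rdot x y| <= nrm x * nrm y.
Proof. by rewrite (le_trans _ (cauchy_schwarz x y))// Re_le_norm. Qed.

Lemma bounded_operatorP T : bounded_operator T <->
  linear T /\ exists2 K : R, 0 <= K & forall x, nrm (T x) <= K * nrm x.
Proof.
split=> -[lT].
  pose TT := GRing.isLinear.Build R[i] H H *:%R T lT.
  pose TL : {linear H -> H} := HB.pack T TT.
  move=> cT; split=> //.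
  have /linear_boundedP [K [Kr hK]] : bounded_near TL (nbhs (0 : H)).
    by apply/linear_bounded_continuous.
  pose K' := complex.Re K.
  have KK' : K = K'%:C by rewrite RRe_real.
  (* [K] may be negative, and the bound holds only for constants strictly above it. *)
  exists (`|K'| + 1) => [|x]; first by rewrite addr_ge0.
  have h1 : K < (`|K'| + 1)%:C.
    by rewrite KK' ltcR (le_lt_trans (ler_norm _))// ltrDl.
  have := hK _ h1 x; rewrite /= !nrmE -(rmorphM (real_complex R)) lecR.
  exact.
move=> [K K0 hK]; split=> //.
pose TT := GRing.isLinear.Build R[i] H H *:%R T lT.
pose TL : {linear H -> H} := HB.pack T TT.
rewrite -[T]/(TL : H -> H); apply/linear_bounded_continuous/linear_boundedP.
exists K%:C; split; first by rewrite complex_real.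
move=> M KM x; rewrite (le_trans (_ : _ <= K%:C * `|x|))//.
  by rewrite !nrmE -(rmorphM (real_complex R)) lecR.
by rewrite ler_wpM2r// ltW.
Qed.

Section LinearFun.
Variables (T : H -> H) (lT : linear T).
Lemma lin0 : T 0 = 0.
Proof. by have := lT (-1) 0 0; rewrite scaler0 add0r scaleN1r addNr. Qed.
Lemma linD x y : T (x + y) = T x + T y.
Proof. by have := lT 1 x y; rewrite !scale1r. Qed.
Lemma linZ (a : R[i]) x : T (a *: x) = a *: T x.
Proof. by have := lT a x 0; rewrite !addr0 lin0 addr0. Qed.
Lemma linN x : T (- x) = - T x.
Proof. by rewrite -scaleN1r linZ scaleN1r. Qed.
Lemma linB x y : T (x - y) = T x - T y.
Proof. by rewrite linD linN. Qed.
End LinearFun.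

Definition op_bound T (K : R) := forall x, nrm (T x) <= K * nrm x.

Lemma op_norm_ge0 T : 0 <= op_norm T.
Proof.
(* For an unbounded [T], [sup] takes its default value 0. *)
have [e|e] := pselect (has_sup [set complex.Re `|T x| | x in [set x : H | `|x| <= 1]]);
  last by rewrite /op_norm sup_out.
rewrite (le_trans (nrm_ge0 (T 0)))// ub_le_sup //; first by case: e.
by exists 0 => //=; rewrite normr0.
Qed.

Lemma op_normP T x : bounded_operator T -> nrm (T x) <= op_norm T * nrm x.
Proof.
move=> /bounded_operatorP [lT [K K0 hK]].
have [->|x0] := eqVneq x 0; first by rewrite lin0// nrm0 mulr0.
have nx := nrm_gt0 x0.
rewrite -ler_pdivrMr//.
have -> : nrm (T x) / nrm x = nrm (T ((nrm x)^-1%:C *: x)).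
  by rewrite linZ// nrmZr mulrC ger0_norm// invr_ge0 ltW.
apply: ub_le_sup.
  exists K => _ [y /= y1 <-]; rewrite -/(nrm _) (le_trans (hK y))//.
  by rewrite -[leRHS]mulr1 ler_wpM2l// -lecR -nrmE.
exists ((nrm x)^-1%:C *: x) => //=.
by rewrite nrmE -[leRHS]/(1%:C) lecR nrmZr ger0_norm ?invr_ge0 ?nrm_ge0// mulVf ?gt_eqF.
Qed.

Lemma op_norm_le T (K : R) : 0 <= K -> op_bound T K -> op_norm T <= K.
Proof.
move=> K0 hK; apply: ge_sup; first by exists (nrm (T 0)), 0 => //=; rewrite normr0.
move=> _ [y /= y1 <-]; rewrite -/(nrm _) (le_trans (hK y))//.
by rewrite -[leRHS]mulr1 ler_wpM2l// -lecR -nrmE.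
Qed.

End HilbertSpace.

(** * Polynomials of an operator and positivity *)

Section OperatorPolynomials.
Context {R : realType} {Omega : Type} {H : functional_hilbert R Omega}.
Implicit Types (x y : H) (S T : H -> H) (c z : R[i]) (t : R).
Variable A : H -> H.
Hypothesis lA : linear A.

Local Notation "''[' u , v ]" := (fh_dot H u v) : ring_scope.

(** The complex-coefficient twin of [op_horner]: real polynomials are moved here to be split into
    linear factors. *)
Definition op_poly (p : {poly R[i]}) x : H := \sum_(i < size p) p`_i *: iter i A x.

Lemma op_poly_wide n (p : {poly R[i]}) x : (size p <= n)%N ->
  op_poly p x = \sum_(i < n) p`_i *: iter i A x.
Proof.
move=> pn; rewrite /op_poly (big_ord_widen n (fun i => p`_i *: iter i A x) pn).
rewrite big_mkcond; apply: eq_bigr => i _; case: ltnP => // /(nth_default 0) ->.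
by rewrite scale0r.
Qed.

Lemma op_polyD p q x : op_poly (p + q) x = op_poly p x + op_poly q x.
Proof.
rewrite (op_poly_wide x (size_polyD p q)) (op_poly_wide x (leq_maxl _ (size q))).
rewrite (op_poly_wide x (leq_maxr (size p) _)) -big_split; apply: eq_bigr => i _.
by rewrite coefD scalerDl.
Qed.

Lemma op_polyZ c p x : op_poly (c *: p) x = c *: op_poly p x.
Proof.
rewrite (op_poly_wide x (size_scale_leq c p)) scaler_sumr; apply: eq_bigr => i _.
by rewrite coefZ scalerA.
Qed.

Lemma op_polyC c x : op_poly c%:P x = c *: x.
Proof. by rewrite (op_poly_wide x (size_polyC_leq1 c)) big_ord1 coefC. Qed.

Lemma op_polyMX p x : op_poly (p * 'X) x = op_poly p (A x).
Proof.
rewrite (@op_poly_wide (size p).+1).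
  rewrite big_ord_recl coefMX scale0r add0r; apply: eq_bigr => i _.
  by rewrite coefMX /= -iterSr.
by rewrite (leq_trans (size_polyMleq _ _))// size_polyX addn2.
Qed.

Lemma op_polyX x : op_poly 'X x = A x.
Proof. by rewrite -['X]mul1r op_polyMX op_polyC scale1r. Qed.

Lemma op_polyMXaddC p c x : op_poly (p * 'X + c%:P) x = op_poly p (A x) + c *: x.
Proof. by rewrite op_polyD op_polyMX op_polyC. Qed.

Lemma op_poly_comm p x : op_poly p (A x) = A (op_poly p x).
Proof.
elim/poly_ind: p x => [|p c IH] x; first by rewrite !op_polyC !scale0r lin0.
by rewrite !op_polyMXaddC IH (linD lA) (linZ lA).
Qed.

Lemma op_polyM p q x : op_poly (p * q) x = op_poly p (op_poly q x).
Proof.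
elim/poly_ind: p q => [|p c IH] q; first by rewrite mul0r !op_polyC !scale0r.
rewrite mulrDl -mulrA [_ * q]mulrC mul_polyC op_polyD op_polyZ IH op_polyMX.
by rewrite op_polyMXaddC op_poly_comm.
Qed.

Lemma op_hornerE (p : {poly R}) : op_horner A p = op_poly (map_poly (real_complex R) p).
Proof.
apply/funext => x; rewrite /op_horner /op_poly size_map_poly.
by apply: eq_bigr => i _; rewrite coef_map.
Qed.

Lemma op_hornerD (p q : {poly R}) x : op_horner A (p + q) x = op_horner A p x + op_horner A q x.
Proof. by rewrite !op_hornerE rmorphD op_polyD. Qed.

Lemma op_hornerZ t (p : {poly R}) x : op_horner A (t *: p) x = t%:C *: op_horner A p x.
Proof. by rewrite !op_hornerE linearZ op_polyZ. Qed.

Lemma op_hornerB (p q : {poly R}) x : op_horner A (p - q) x = op_horner A p x - op_horner A q x.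
Proof. by rewrite op_hornerD -scaleN1r op_hornerZ rmorphN scaleN1r. Qed.

Lemma op_hornerC t x : op_horner A t%:P x = t%:C *: x.
Proof. by rewrite op_hornerE map_polyC op_polyC. Qed.

Lemma op_hornerX x : op_horner A 'X x = A x.
Proof. by rewrite op_hornerE map_polyX op_polyX. Qed.

Lemma op_hornerM (p q : {poly R}) x : op_horner A (p * q) x = op_horner A p (op_horner A q x).
Proof. by rewrite !op_hornerE rmorphM op_polyM. Qed.

Lemma op_hornerMXaddC (p : {poly R}) t x :
  op_horner A (p * 'X + t%:P) x = op_horner A p (A x) + t%:C *: x.
Proof. by rewrite op_hornerD op_hornerM op_hornerX op_hornerC. Qed.

Lemma op_horner_linear (p : {poly R}) : linear (op_horner A p).
Proof.
move=> a x y; elim/poly_ind: p x y => [|p c IH] x y.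
  by rewrite !op_hornerC !scale0r scaler0 addr0.
rewrite !op_hornerMXaddC lA IH !scalerDr !scalerA [a * _]mulrC.
by rewrite -!addrA; congr (_ + _); rewrite addrCA.
Qed.

Lemma op_horner_bound (p : {poly R}) K : 0 <= K -> op_bound A K ->
  exists2 L, 0 <= L & op_bound (op_horner A p) L.
Proof.
move=> K0 AK; elim/poly_ind: p => [|p c [L L0 IH]].
  by exists 0 => // x; rewrite op_hornerC scale0r nrm0 mul0r.
exists (L * K + `|c|) => [|x]; first by rewrite addr_ge0// mulr_ge0.
rewrite op_hornerMXaddC (le_trans (le_nrmD _ _))// nrmZr mulrDl lerD2r -mulrA.
by rewrite (le_trans (IH _))// ler_wpM2l.
Qed.

Definition symmetric_operator T := forall x y, '[T x, y] = '[x, T y].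

Lemma symmetric_rdot T x y : symmetric_operator T -> rdot (T x) y = rdot x (T y).
Proof. by move=> sT; rewrite /rdot sT. Qed.

Lemma op_horner_symmetric (p : {poly R}) : symmetric_operator A ->
  symmetric_operator (op_horner A p).
Proof.
move=> sA x y; elim/poly_ind: p x y => [|p c IH] x y.
  by rewrite !op_hornerC !scale0r raddf0 -[0 in LHS](scale0r 0) dotZl mul0r.
rewrite !op_hornerMXaddC dotDl dotDr IH sA dotZl dotZr conjc_real; congr ('[_, _] + _).
by rewrite !op_hornerE op_poly_comm.
Qed.

(** Polarization: the quadratic form is real at [u + v], hence so is <A u, v> + <A v, u>. The pairs
    (x, y) and (x, i y) then make <A y, x> the conjugate of <A x, y>. *)
Lemma positive_symmetric : positive_operator A -> symmetric_operator A.
Proof.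
move=> pA x y.
have im0 u v : complex.Im ('[A u, v] + '[A v, u]) = 0.
  have := ger0_Im (pA (u + v)).
  rewrite (linD lA) dotDl !dotDr addrACA [_ + '[A v, v]]addrC addrCA -addrA !raddfD /=.
  by rewrite !(ger0_Im (pA _)) !add0r addrC.
have imE := im0 x y; have := im0 x ('i *: y).
rewrite (linZ lA) dotZl dotZr (dotC x (A y)).
move: imE; case: '[A x, y] => a b; case: '[A y, x] => c d /=.
by move=> h1 h2; have -> : b = - d; [lra|have -> : a = c by lra].
Qed.

Definition bounded_below T := exists2 c : R, 0 < c & forall x, c * nrm x <= nrm (T x).

Definition approximate_eigenvalue t := ~ bounded_below (fun x => A x - t%:C *: x).

(** An inverse of [A - t] with bound K would force the lower bound 1 / (K + 1); the added 1 covers K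
    = 0. *)
Lemma approximate_eigenvalue_spectrum t : approximate_eigenvalue t -> spectrum A t%:C.
Proof.
move=> nb [S [/bounded_operatorP [lS [K K0 SK]] AS _]]; apply: nb.
exists (K + 1)^-1 => [|x]; first by rewrite invr_gt0 ltr_wpDl.
rewrite ler_pdivrMl ?ltr_wpDl//.
by rewrite (le_trans (_ : _ <= K * nrm (A x - t%:C *: x)))// ?ler_wpM2r ?nrm_ge0 ?lerDl// -{1}[x]AS.
Qed.

(** As <A x, x> is real, <(A - z) x, x> has imaginary part -Im z |x|^2, and Cauchy-Schwarz turns
    this into a lower bound for |(A - z) x|. *)
Lemma bounded_below_imaginary z : symmetric_operator A -> complex.Im z != 0 ->
  bounded_below (fun x => A x - z *: x).
Proof.
move=> sA z0; exists `|complex.Im z| => [|x]; first by rewrite normr_gt0.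
have [->|x0] := eqVneq x 0; first by rewrite nrm0 mulr0 nrm_ge0.
have nx := nrm_gt0 x0.
rewrite -(ler_pM2r nx) (le_trans _ (cauchy_schwarz _ _))//.
have iA : complex.Im '[A x, x] = 0.
  have := dotC (A x) x; rewrite -sA; case: '[A x, x] => a b /= [] /eqP.
  by rewrite -addr_eq0 -mulr2n mulrn_eq0 => /eqP.
rewrite dotBl dotZl rdot_self normc_def /=.
have -> : complex.Im ('[A x, x] - z * (nrm x ^+ 2)%:C) = - complex.Im z * nrm x ^+ 2.
  rewrite raddfB /= iA; case: z {z0} => a b /=; ring.
have -> : `|complex.Im z| * nrm x * nrm x = Num.sqrt ((- complex.Im z * nrm x ^+ 2) ^+ 2).
  by rewrite sqrtr_sqr normrM normrN (ger0_norm (sqr_ge0 _)) expr2 mulrA.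
by rewrite ler_wsqrtr// lerDr sqr_ge0.
Qed.

(** Over the complex numbers [q] splits into linear factors, and a composition of maps bounded below
    is bounded below by the product of the constants. *)
Lemma bounded_below_poly (q : {poly R[i]}) : q != 0 ->
  (forall z, root q z -> bounded_below (fun x => A x - z *: x)) ->
  bounded_below (op_poly q).
Proof.
move=> q0 bq; have [r rE] := closed_field_poly_normal q.
have {bq} : forall z, z \in r -> bounded_below (fun x => A x - z *: x).
  by move=> z zr; apply: bq; rewrite rE rootZ ?lead_coef_eq0// root_prod_XsubC.
have a0 : 0 < complex.Re `|lead_coef q|.
  by rewrite -ltcR ReK// normr_gt0 lead_coef_eq0.
rewrite rE; move: (lead_coef q) a0 => a a0 {rE q0 q}.
suff h : (forall z, z \in r -> bounded_below (fun x => A x - z *: x)) ->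
    bounded_below (op_poly (\prod_(z <- r) ('X - z%:P))).
  move=> /h [c c0 hc]; exists (complex.Re `|a| * c) => [|x]; first exact: mulr_gt0.
  by rewrite op_polyZ nrmZ -mulrA ler_wpM2l// ltW.
elim: r => [|z r IH] br.
  by exists 1 => // x; rewrite big_nil op_polyC scale1r mul1r.
have [|c c0 hc] := IH; first by move=> w wr; apply: br; rewrite inE wr orbT.
have [d d0 hd] := br z (mem_head _ _); exists (d * c) => [|x]; first exact: mulr_gt0.
rewrite big_cons op_polyM op_polyD op_polyX -polyCN op_polyC scaleNr.
by rewrite (le_trans _ (hd _))// -mulrA ler_wpM2l// ltW.
Qed.

End OperatorPolynomials.

(** * Numerical range and approximate point spectrum of symmetric operators *)

Section NumericalRange.
Context {R : realType} {Omega : Type} {H : functional_hilbert R Omega}.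
Implicit Types (x y : H) (S T : H -> H) (z : R[i]) (t : R).

(** Positivity at x - K^-1 T x reads 0 <= <T x, x> - 2 K^-1 |T x|^2 + K^-2 <T T x, T x>, and the
    last term is at most K^-1 |T x|^2. *)
Lemma psd_nrm_sq T K x : linear T -> symmetric_operator T -> 0 < K -> op_bound T K ->
  (forall y, 0 <= rdot (T y) y) -> nrm (T x) ^+ 2 <= K * rdot (T x) x.
Proof.
move=> lT sT K0 TK pT.
have := pT (x - K^-1%:C *: T x).
rewrite (linB lT) (linZ lT) rdotBl !rdotBr !rdotZl !rdotZr (symmetric_rdot (T x) x sT).
rewrite -!nrm_sq.
have h : K^-1 * rdot (T (T x)) (T x) <= nrm (T x) ^+ 2.
  rewrite ler_pdivrMl// (le_trans (rdot_le _ _))// expr2 mulrA ler_wpM2r ?nrm_ge0//.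
have {h} := ler_wpM2l (ltW (_ : 0 < K^-1)) h; rewrite invr_gt0 => /(_ K0) h h2.
rewrite -ler_pdivrMl//; lra.
Qed.

(** The witness m is the infimum of <S x, x> over unit vectors, so S - m is positive. A lower bound
    c for S - m would give, by [psd_nrm_sq], <S x, x> >= m + c^2 / (K + |m|) on unit vectors,
    contradicting the choice of m. *)
Lemma numerical_range_inf S K x0 : linear S -> symmetric_operator S -> 0 <= K ->
  op_bound S K -> rdot (S x0) x0 < 0 ->
  exists2 m : R, m < 0 & ~ bounded_below (fun x => S x - m%:C *: x).
Proof.
move=> lS sS K0 SK neg.
pose E := [set rdot (S x) x | x in [set x : H | nrm x = 1]].
have unitE x : x != 0 -> E (rdot (S x) x / nrm x ^+ 2).
  move=> /nrm_gt0 nx; exists ((nrm x)^-1%:C *: x) => /=.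
    by rewrite nrmZr ger0_norm ?invr_ge0 ?ltW// mulVf// gt_eqF.
  by rewrite (linZ lS) rdotZl rdotZr; field; rewrite gt_eqF.
have x0n : x0 != 0 by apply: contraTneq neg => ->; rewrite (lin0 lS) rdot0l ltxx.
have lbE : has_lbound E.
  exists (- K) => _ [x /= x1 <-]; have := abs_rdot_le (S x) x; rewrite x1 mulr1.
  move=> /ler_normlP [h _]; rewrite lerNl (le_trans h)//.
  by rewrite (le_trans (SK x))// x1 mulr1.
set m := inf E.
have mE x : m * nrm x ^+ 2 <= rdot (S x) x.
  have [->|/[dup] x1 /nrm_gt0 nx] := eqVneq x 0.
    by rewrite (lin0 lS) rdot0l nrm0 expr0n mulr0.
  by rewrite -ler_pdivlMr ?exprn_gt0//; apply: ge_inf => //; exact: unitE.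
have m0 : m < 0.
  rewrite (le_lt_trans (ge_inf lbE (unitE _ x0n)))// pmulr_llt0// invr_gt0 exprn_gt0//.
  exact: nrm_gt0.
exists m => // -[c c0 hc].
pose Q x := S x - m%:C *: x.
have lQ : linear Q.
  move=> a x y; rewrite /Q lS scalerBr scalerDr !scalerA [_ * a]mulrC opprD.
  by rewrite addrACA.
have sQ : symmetric_operator Q.
  by move=> x y; rewrite /Q dotBl dotBr sS dotZl dotZr conjc_real.
have K'0 : 0 < K + `|m| by rewrite ltr_wpDl// normr_gt0 lt_eqF.
have QK : op_bound Q (K + `|m|).
  by move=> x; rewrite (le_trans (le_nrmB _ _))// nrmZr mulrDl lerD2r.
have Qp y : 0 <= rdot (Q y) y by rewrite rdotBl rdotZl -nrm_sq subr_ge0.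
suff : m + c ^+ 2 / (K + `|m|) <= m.
  by rewrite gerDl leNgt divr_gt0// exprn_gt0.
apply: lb_le_inf; first by exists (rdot (S x0) x0 / nrm x0 ^+ 2); exact: unitE.
move=> _ [x /= x1 <-].
have := psd_nrm_sq x lQ sQ K'0 QK Qp.
rewrite rdotBl rdotZl -nrm_sq x1 expr1n mulr1 mulrC -ler_pdivrMr// => h.
rewrite -lerBrDl (le_trans _ h)// ler_wpM2r ?invr_ge0 ?(ltW K'0)//.
by rewrite ler_pXn2r ?nnegrE ?nrm_ge0 ?(ltW c0)//; have := hc x; rewrite x1 mulr1.
Qed.

Variables (A : H -> H) (K : R).
Hypotheses (lA : linear A) (sA : symmetric_operator A) (K0 : 0 <= K) (AK : op_bound A K).

(* The infimum m of the numerical range of p(A) is an approximate eigenvalue of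
   p(A); factoring p - m over the complex numbers, some A - z with p(z) = m is
   not bounded below, and z is real since A is symmetric. *)
Let op_horner_ge0_nonconstant (p : {poly R}) x : (1 < size p)%N ->
  (forall t, approximate_eigenvalue A t -> 0 <= p.[t]) -> 0 <= rdot (op_horner A p x) x.
Proof.
move=> p1 pA; rewrite leNgt; apply/negP => neg.
have [L L0 pL] := op_horner_bound lA p K0 AK.
have [m m0] := numerical_range_inf (op_horner_linear lA p) (op_horner_symmetric lA p sA) L0 pL neg.
apply.
have -> : (fun x => op_horner A p x - m%:C *: x) = op_poly A (map_poly (real_complex R) (p - m%:P)).
  by rewrite -op_hornerE; apply/funext => y; rewrite op_hornerB// op_hornerC.
apply: bounded_below_poly => //.
  rewrite map_poly_eq0; apply: contraTneq p1 => /eqP; rewrite subr_eq0 => /eqP ->.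
  by rewrite -leqNgt size_polyC_leq1.
move=> z; have [z0|/(bounded_below_imaginary sA)//] := eqVneq (complex.Im z) 0.
have -> : z = (complex.Re z)%:C by case: z z0 => a b /= ->.
rewrite fmorph_root rootE hornerD hornerN hornerC subr_eq0 => /eqP pz.
apply: contrapT => /pA; rewrite pz; apply/negP; by rewrite -ltNge.
Qed.

(** Otherwise the positivity statement holds vacuously for every nonconstant polynomial, yet X - (K
    + 1) is negative at [A]. *)
Lemma approximate_eigenvalue_exists x0 : x0 != 0 :> H -> exists t, approximate_eigenvalue A t.
Proof.
move=> x00; apply: contrapT => /forallNP no.
have h (p : {poly R}) x : (1 < size p)%N -> 0 <= rdot (op_horner A p x) x.
  by move=> p1; apply: op_horner_ge0_nonconstant => // t /no.
have := h ('X - (K + 1)%:P) x0; rewrite size_XsubC => /(_ isT).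
rewrite op_hornerB// op_hornerX// op_hornerC rdotBl rdotZl -nrm_sq.
have := rdot_le (A x0) x0; have := ler_wpM2r (nrm_ge0 x0) (AK x0).
have := nrm_gt0 x00; nra.
Qed.

Lemma op_horner_ge0 (p : {poly R}) x :
  (forall t, approximate_eigenvalue A t -> 0 <= p.[t]) -> 0 <= rdot (op_horner A p x) x.
Proof.
move=> pA; have [->|x0] := eqVneq x 0.
  by rewrite (lin0 (op_horner_linear lA p)) rdot0l.
have [|p1] := ltnP 1 (size p); first by move=> /op_horner_ge0_nonconstant; exact.
(* A constant polynomial gets its sign from the hypothesis only once some approximate eigenvalue is
   at hand. *)
have [t /pA] := approximate_eigenvalue_exists x0.
rewrite (size1_polyC p1) hornerC op_hornerC rdotZl -nrm_sq => p0.
by rewrite mulr_ge0// sqr_ge0.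
Qed.

(** Positivity of e^2 - p^2 at [A], where <p(A)^2 x, x> = |p(A) x|^2 by symmetry. *)
Lemma op_horner_nrm (p : {poly R}) (e : R) x : 0 <= e ->
  (forall t, approximate_eigenvalue A t -> `|p.[t]| <= e) ->
  nrm (op_horner A p x) <= e * nrm x.
Proof.
move=> e0 pe; rewrite -(@ler_pXn2r _ 2)// ?nnegrE ?mulr_ge0 ?nrm_ge0//.
have := @op_horner_ge0 ((e ^+ 2)%:P - p * p) x.
rewrite op_hornerB// op_hornerC op_hornerM// rdotBl rdotZl.
rewrite (symmetric_rdot _ _ (op_horner_symmetric lA p sA)) -!nrm_sq subr_ge0 exprMn.
apply=> t /pe; rewrite hornerD hornerN hornerC hornerM subr_ge0 -expr2 => pte.
by rewrite -[p.[t] ^+ 2]real_normK ?num_real// ler_pXn2r// nnegrE.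
Qed.

End NumericalRange.

(** * Weierstrass approximation *)

Section Weierstrass.
Context {R : realType}.
Implicit Types (f : R -> R) (g h : nat -> R) (x t M B e s u v w : R).

(** Restricting to [e <= 1] lets users absorb e^2 into e. If r > 0, then e = 1 gives C > 0, and e =
    r / (2C) gives r <= r / 2. *)
Lemma le0_of_small (r C : R) : (forall e, 0 < e <= 1 -> r <= e * C) -> r <= 0.
Proof.
move=> h; rewrite leNgt; apply/negP => r0.
have rC : r <= C by rewrite -[C]mul1r h// ltr01 lexx.
have C0 : 0 < C by exact: lt_le_trans r0 rC.
have /h : 0 < r / (2 * C) <= 1.
  by rewrite divr_gt0 ?mulr_gt0//= ler_pdivrMr ?mulr_gt0//; lra.
have -> : r / (2 * C) * C = r / 2 by field; rewrite gt_eqF.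
by move=> ?; lra.
Qed.

Lemma natSinv_small (e : R) : 0 < e -> exists n : nat, n.+1%:R^-1 <= e.
Proof.
move=> e0; have [n _ hn] := near_infty_natSinv_lt (PosNum e0).
by exists n; apply/ltW/hn => /=.
Qed.

Lemma le0_of_natSinv (r C : R) : (forall n : nat, r <= n.+1%:R^-1 * C) -> r <= 0.
Proof.
move=> h; have C0 : r <= `|C|.
  by rewrite (le_trans (h 0%N))// invr1 mul1r ler_norm.
apply: (@le0_of_small _ `|C|) => e /andP[/natSinv_small[n hn] _].
rewrite (le_trans (h n))// (le_trans (_ : _ <= n.+1%:R^-1 * `|C|))//.
  by rewrite ler_wpM2l// ?invr_ge0// ler_norm.
by rewrite ler_wpM2r.
Qed.

(* sum_k g(k) C(n,k) X^k (1-X)^(n-k), in the recursive form of de Casteljau *)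
Fixpoint bernstein n g : {poly R} :=
  if n is m.+1 then (1 - 'X) * bernstein m g + 'X * bernstein m (fun k => g k.+1)
  else (g 0%N)%:P.

Lemma bernsteinS n g x : (bernstein n.+1 g).[x] =
  (1 - x) * (bernstein n g).[x] + x * (bernstein n (fun k => g k.+1)).[x].
Proof. by rewrite /= !hornerE. Qed.

Lemma bernstein_cstB n g c x :
  (bernstein n g).[x] - c = (bernstein n (fun k => g k - c)).[x].
Proof.
by elim: n g => [|n IH] g; [rewrite /= !hornerC|rewrite !bernsteinS -!IH; ring].
Qed.

Lemma le_bernstein_norm n g h x : 0 <= x <= 1 ->
  (forall k, (k <= n)%N -> `|g k| <= h k) -> `|(bernstein n g).[x]| <= (bernstein n h).[x].
Proof.
move=> /andP[x0 x1]; elim: n g h => [|n IH] g h gh.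
  by rewrite /= !hornerC gh.
rewrite !bernsteinS (le_trans (ler_normD _ _))// !normrM (ger0_norm x0).
rewrite ger0_norm ?subr_ge0// lerD// ler_wpM2l ?subr_ge0// IH// => k kn.
  by rewrite gh// leqW.
by rewrite gh.
Qed.

(** Second moment of the binomial law about [a]: variance n x (1 - x) plus squared bias. The
    recursion shifts the index, which replaces a by a - 1, so the induction runs over all [a]. *)
Lemma bernstein_square n c C a x :
  (bernstein n (fun k => c + C * (k%:R - a) ^+ 2)).[x] =
  c + C * (n%:R * x * (1 - x) + (n%:R * x - a) ^+ 2).
Proof.
elim: n a => [|n IH] a; first by rewrite /= hornerC; ring.
rewrite bernsteinS IH.
have -> : (fun k => c + C * (k.+1%:R - a) ^+ 2) = (fun k => c + C * (k%:R - (a - 1)) ^+ 2).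
  by apply/funext => k; rewrite -natr1; ring.
by rewrite IH -natr1; ring.
Qed.

Definition uniformly_continuous_upto M f := forall e, 0 < e -> exists2 d : R, 0 < d &
  forall x y : R, 0 <= x <= M -> 0 <= y <= M -> `|x - y| < d -> `|f x - f y| < e.

(** Bernstein's proof with Chebyshev's estimate: at each node |f(M k / N) - f(t)| is dominated by e
    / 2 plus a multiple of (k - N x)^2, whose Bernstein average is explicit. *)
Lemma weierstrass f M B e : 0 < M -> (forall x, 0 <= x <= M -> `|f x| <= B) ->
  uniformly_continuous_upto M f -> 0 < e ->
  exists p : {poly R}, forall t, 0 <= t <= M -> `|p.[t] - f t| <= e.
Proof.
move=> M0 fB uf e0.
have B0 : 0 <= B by rewrite (le_trans (normr_ge0 (f 0)))// fB// lexx ltW.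
have e20 : 0 < e / 2 by rewrite divr_gt0.
have [d d0 hd] := uf _ e20.
(* At nodes with |M k / N - t| >= d, 2 B is at most 2 B (M k / N - t)^2 / d^2, which is D / N^2 (k -
   N x)^2 for x = t / M. *)
pose D := 2 * B * M ^+ 2 / d ^+ 2.
have D0 : 0 <= D by rewrite !mulr_ge0// ?invr_ge0 ?exprn_ge0// ltW.
have [n hn] : exists n : nat, n.+1%:R^-1 <= e / 2 / (D + 1).
  by apply: natSinv_small; rewrite divr_gt0// ltr_wpDl.
pose N : R := n.+1%:R.
have N0 : 0 < N by rewrite ltr0n.
exists (bernstein n.+1 (fun k => f (M * (k%:R / N))) \Po (M^-1 *: 'X)) => t /andP[t0 tM].
rewrite horner_comp hornerZ hornerX.
set x := M^-1 * t.
have tE : t = M * x by rewrite mulrA divff ?mul1r// gt_eqF.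
have x01 : 0 <= x <= 1.
  apply/andP; split; first by rewrite mulr_ge0 ?invr_ge0// ltW.
  by rewrite /x mulrC ler_pdivrMr// mul1r.
have [x0 x1] := andP x01.
rewrite bernstein_cstB.
apply: le_trans (le_bernstein_norm
  (h := fun k => e / 2 + D / N ^+ 2 * (k%:R - N * x) ^+ 2) x01 _) _.
  move=> k kn.
  have kN : 0 <= M * (k%:R / N) <= M.
    rewrite mulr_ge0 ?mulr_ge0 ?invr_ge0 ?(ltW N0) ?(ltW M0)//=.
    by rewrite ler_piMr ?(ltW M0)// ler_pdivrMr// mul1r ler_nat.
  have C0 : 0 <= D / N ^+ 2 * (k%:R - N * x) ^+ 2.
    by rewrite mulr_ge0 ?sqr_ge0// mulr_ge0 ?invr_ge0 ?sqr_ge0.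
  have [lt_d|ge_d] := ltP `|M * (k%:R / N) - t| d.
    rewrite ltW// (lt_le_trans (hd _ _ kN _ lt_d)) ?lerDl// t0 tM//.
  rewrite (le_trans (_ : _ <= 2 * B)) //.
    rewrite (le_trans (ler_normB _ _))//.
    by have := fB _ kN; have := fB t; rewrite t0 tM => /(_ isT); lra.
  have -> : D / N ^+ 2 * (k%:R - N * x) ^+ 2 = 2 * B * ((M * (k%:R / N) - t) ^+ 2 / d ^+ 2).
    by rewrite /D tE; field; rewrite !gt_eqF.
  rewrite (le_trans (_ : _ <= 2 * B * ((M * (k%:R / N) - t) ^+ 2 / d ^+ 2)))//; last first.
    by rewrite lerDr ltW.
  rewrite ler_peMr ?mulr_ge0// ler_pdivlMr ?exprn_gt0// mul1r.
  by rewrite -[leRHS]real_normK ?num_real// ler_pXn2r// nnegrE ltW.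
rewrite bernstein_square -/N subrr expr0n addr0.
have -> : D / N ^+ 2 * (N * x * (1 - x)) = D / N * (x * (1 - x)) by field; rewrite gt_eqF.
rewrite (le_trans (_ : _ <= e / 2 + D / N * 1))//.
  rewrite lerD2l ler_wpM2l// ?mulr_ge0 ?invr_ge0 ?(ltW N0)//; nra.
rewrite mulr1 [leRHS]splitr lerD2l.
move: hn; rewrite ler_pdivlMr ?ltr_wpDl// -/N => hn; rewrite (le_trans _ hn)//.
by rewrite mulrC ler_wpM2l ?invr_ge0 ?(ltW N0)// lerDl.
Qed.

(** A fraction w / (u + v) in [0, 1] is at most its own s-th power; add the cases w = u and w =
    v. *)
Lemma le_powRD (s u v : R) : 0 <= s <= 1 -> 0 <= u -> 0 <= v ->
  (u + v) `^ s <= u `^ s + v `^ s.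
Proof.
move=> /andP[s0 s1] u0 v0.
have [uv0|] := ltP 0 (u + v); last first.
  move=> uv; have -> : u = 0 by lra.
  by rewrite add0r lerDr powR_ge0.
have h w : 0 <= w <= u + v -> w / (u + v) * (u + v) `^ s <= w `^ s.
  move=> /andP[w0 wuv]; have [->|wn] := eqVneq w 0; first by rewrite !mul0r powR_ge0.
  have wE : w `^ s = (w / (u + v)) `^ s * (u + v) `^ s.
    by rewrite -powRM ?divr_ge0 ?(ltW uv0)// divfK// gt_eqF.
  rewrite wE ler_wpM2r ?powR_ge0// ger1_powR//.
  have wp : 0 < w by rewrite lt_neqAle eq_sym wn.
  by apply/andP; split; [exact: divr_gt0|rewrite ler_pdivrMr// mul1r].
have : (u + v) `^ s = u / (u + v) * (u + v) `^ s + v / (u + v) * (u + v) `^ s.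
  by rewrite -mulrDl -mulrDl divff ?mul1r// gt_eqF.
by move=> ->; rewrite lerD// h// ?u0 ?v0 ?lerDl ?lerDr.
Qed.

Lemma powR_distr (s x y : R) : 0 <= s <= 1 -> 0 <= x -> 0 <= y ->
  `|x `^ s - y `^ s| <= `|x - y| `^ s.
Proof.
move=> s01 x0 y0; wlog xy : x y x0 y0 / y <= x.
  by move=> h; have [|/ltW] := leP y x; [exact: h|rewrite distrC [`|x - y|]distrC; exact: h].
have s0 : 0 <= s by case/andP: s01.
rewrite !ger0_norm ?subr_ge0// ?ge0_ler_powR ?nnegrE//.
rewrite lerBlDr -{1}(subrK y x) le_powRD// subr_ge0//.
Qed.

(** Write t^s = (t^q)^N with q = s / N in (0, 1]: t^q is Hölder by [powR_distr], and the N-th power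
    is Lipschitz with constant [L] on the range of t^q. The exponent 0 is separate, since q would be
    0. *)
Lemma powR_uniformly_continuous (s M : R) : 0 <= s -> 0 <= M ->
  uniformly_continuous_upto M (fun t => t `^ s).
Proof.
move=> s0 M0 e e0.
have [->|sn] := eqVneq s 0.
  by exists 1 => // x y _ _ _; rewrite !powRr0 subrr normr0.
have [n sn1] : exists n : nat, s <= n.+1%:R.
  exists (Num.truncn s); exact/ltW/truncnS_gt.
pose N : R := n.+1%:R; pose q := s / N.
have N0 : 0 < N by rewrite ltr0n.
have q01 : 0 < q <= 1.
  by rewrite divr_gt0// ?lt_neqAle ?s0 1?eq_sym ?sn//= ler_pdivrMr// mul1r.
have [q0 q1] := andP q01.
have sE t : t `^ s = (t `^ q) ^+ n.+1.
  by rewrite -powR_mulrn ?powR_ge0// -powRrM /q divfK// gt_eqF.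
pose L := N * (M `^ q + 1) ^+ n.
have L0 : 0 < L by rewrite mulr_gt0// exprn_gt0// ltr_wpDl// powR_ge0.
exists ((e / L) `^ q^-1) => [|x y /andP[x0 xM] /andP[y0 yM] xy].
  by rewrite powR_gt0// divr_gt0.
rewrite !sE subrXX normrM.
have h1 : `|x `^ q - y `^ q| < e / L.
  apply: (le_lt_trans (powR_distr _ _ _)) => //; first by rewrite (ltW q0).
  have -> : e / L = ((e / L) `^ q^-1) `^ q.
    by rewrite -powRrM mulVf ?gt_eqF// powRr1// ltW// divr_gt0.
  by rewrite gt0_ltr_powR// ?nnegrE ?powR_ge0.
have h2 : `|\sum_(i < n.+1) (x `^ q) ^+ (n.+1.-1 - i) * (y `^ q) ^+ i| <= L.
  rewrite (le_trans (ler_norm_sum _ _ _))//.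
  rewrite (le_trans (_ : _ <= \sum_(i < n.+1) (M `^ q + 1) ^+ n))//; last first.
    by rewrite sumr_const card_ord /L mulr_natl.
  apply: ler_sum => i _ /=.
  have -> : (M `^ q + 1) ^+ n = (M `^ q + 1) ^+ (n - i) * (M `^ q + 1) ^+ i.
    by rewrite -exprD subnK// -ltnS ltn_ord.
  have b t : 0 <= t -> t <= M -> t `^ q <= M `^ q + 1.
    by move=> t0 tM; rewrite (le_trans (ge0_ler_powR (ltW q0) _ _ tM)) ?nnegrE// lerDl.
  rewrite ger0_norm ?mulr_ge0 ?exprn_ge0 ?powR_ge0//.
  by rewrite ler_pM ?exprn_ge0 ?powR_ge0// lerXn2r ?nnegrE ?powR_ge0 ?b// addr_ge0 ?powR_ge0.
rewrite (le_lt_trans (ler_wpM2l _ h2))//.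
by rewrite -ltr_pdivlMr.
Qed.

Lemma weierstrass_seq f M B : 0 < M -> (forall x, 0 <= x <= M -> `|f x| <= B) ->
  uniformly_continuous_upto M f ->
  exists p : nat -> {poly R}, forall n t, 0 <= t <= M -> `|(p n).[t] - f t| <= n.+1%:R^-1.
Proof.
move=> M0 fB uf.
have /choice [p hp] : forall n : nat, exists p : {poly R},
    forall t, 0 <= t <= M -> `|p.[t] - f t| <= n.+1%:R^-1.
  by move=> n; apply: weierstrass fB uf _ => //; rewrite invr_gt0 ltr0n.
by exists p.
Qed.

End Weierstrass.

(** * Existence of the functional calculus *)

Lemma uniform_cvgP {R : realType} (D : set R) (g : nat -> R -> R) (f : R -> R) :
  {uniform D, g @ \oo --> f} <->
  forall e, 0 < e -> \forall n \near \oo, forall t, D t -> `|g n t - f t| <= e.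
Proof.
split=> [gf e e0|gf P /uniform_nbhs [E [entE EP]]].
  apply: (gf [set k | forall t, D t -> `|k t - f t| <= e]).
  apply/uniform_nbhs; exists [set xy | ball xy.1 e xy.2]; split.
    exact: entourage_ball (PosNum e0).
  by move=> k /= kb t /kb; rewrite -ball_normE /= distrC => /ltW.
move: entE; rewrite -entourage_ballE => -[e /= e0 sub].
have e20 : 0 < e / 2 by rewrite divr_gt0.
apply: filterS (gf _ e20) => n gn; apply: EP => t Dt; apply: sub => /=.
rewrite -ball_normE /= distrC (le_lt_trans (gn _ Dt))//.
by rewrite ltr_pdivrMr// ltr_pMr// ltrDl.
Qed.

Section FunctionalCalculus.
Context {R : realType} {Omega : Type} {H : functional_hilbert R Omega}.
Implicit Types (x y : H) (S T : H -> H) (s t e M : R) (f : R -> R).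

Local Notation "''[' u , v ]" := (fh_dot H u v) : ring_scope.

(** Completeness with the rate kept: this makes pointwise limits of operators into norm limits in
    [op_cauchy_cvg]. *)
Lemma nrm_cauchy_cvg (v : nat -> H) (C : R) :
  (forall n m, nrm (v n - v m) <= (n.+1%:R^-1 + m.+1%:R^-1) * C) ->
  exists l : H, forall n, nrm (v n - l) <= n.+1%:R^-1 * C.
Proof.
move=> vC; pose D : R := `|C| + 1.
have D0 : 0 < D by rewrite ltr_wpDl.
have CD : C <= D by rewrite (le_trans (ler_norm _))// lerDl.
have u_lt e : 0 < e -> \forall n \near \oo, n.+1%:R^-1 * D < e.
  move=> e0; have eD : 0 < e / D by rewrite divr_gt0.
  near=> n; rewrite -ltr_pdivlMr//; near: n.
  exact: near_infty_natSinv_lt (PosNum eD).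
have : cvgn v.
  apply/cauchy_cvgP/cauchy_ballP => e e0; near_simpl.
  have e0' : 0 < complex.Re e by rewrite -ltcR ReK// ltW.
  have e20 : 0 < complex.Re e / 2 by rewrite divr_gt0.
  near=> n m => /=; rewrite -ball_normE /= -[e]ReK ?ltW// nrmE ltcR.
  rewrite (le_lt_trans (vC _ _))// (le_lt_trans (ler_wpM2l _ CD)) ?addr_ge0//.
  rewrite mulrDl [ltRHS]splitr ltrD//; [near: n|near: m]; exact: u_lt.
move=> /cvg_ex [l vl]; exists l => n; rewrite -subr_le0.
(* One [e] pays for |v m - l|, the other for the term D / (m + 1), with m taken large. *)
apply: (@le0_of_small _ _ (1 + 1)) => e /andP[e0 _].
have /cvgrPdist_lt/(_ e%:C) := vl; rewrite ltcR => /(_ e0) le.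
have [m /=] := filter_ex (filterI le (u_lt _ e0)).
rewrite nrmE ltcR => -[lm um].
have := le_nrmD (v n - v m) (v m - l); rewrite subrKA [nrm (v m - l)]nrmB.
have := vC n m; have := ler_wpM2l (_ : 0 <= m.+1%:R^-1) CD; rewrite invr_ge0 => /(_ (ler0n _ _)).
move: um; move: (n.+1%:R^-1 : R) (m.+1%:R^-1 : R) => a b.
move: lm; rewrite mulrDl; lra.
Unshelve. all: by end_near.
Qed.

Lemma op_cauchy_cvg (Tn : nat -> H -> H) : (forall n, linear (Tn n)) ->
  (forall n m x, nrm (Tn n x - Tn m x) <= (n.+1%:R^-1 + m.+1%:R^-1) * nrm x) ->
  exists2 T, linear T & forall n x, nrm (Tn n x - T x) <= n.+1%:R^-1 * nrm x.
Proof.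
move=> lT cT.
have /choice [T hT] : forall x, exists l, forall n, nrm (Tn n x - l) <= n.+1%:R^-1 * nrm x.
  by move=> x; apply: nrm_cauchy_cvg.
exists T => // a x y; apply/eqP; rewrite -subr_eq0; apply/eqP/nrm_eq0/eqP.
rewrite eq_le nrm_ge0 andbT.
apply: (@le0_of_natSinv _ _ (nrm (a *: x + y) + (complex.Re `|a| * nrm x + nrm y))) => n.
have -> : T (a *: x + y) - (a *: T x + T y) =
    - (Tn n (a *: x + y) - T (a *: x + y)) + (a *: (Tn n x - T x) + (Tn n y - T y)).
  by rewrite lT scalerBr opprB [X in _ = _ + X]addrACA -opprD addrA subrK.
have a0 : 0 <= complex.Re `|a| by rewrite -ler0c ReK.
rewrite (le_trans (le_nrmD _ _))// nrmN mulrDr lerD//.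
rewrite (le_trans (le_nrmD _ _))// nrmZ mulrDr lerD// mulrCA.
by rewrite ler_wpM2l.
Qed.

Section PositiveOperator.
Variables (A : H -> H) (M : R).
Hypotheses (lA : linear A) (pA : positive_operator A) (M0 : 0 < M) (AM : op_bound A M).

Let sA : symmetric_operator A := positive_symmetric lA pA.

(** For t < 0 positivity gives <(A - t) x, x> >= -t |x|^2; for t > M the triangle inequality leaves
    the lower bound t - M. *)
Lemma approximate_eigenvalue_ge0_le t : approximate_eigenvalue A t -> 0 <= t <= M.
Proof.
move=> At; apply/andP; split; rewrite leNgt; apply/negP => ht; apply: At.
  exists (- t) => [|x]; first by rewrite oppr_gt0.
  have [->|/nrm_gt0 nx] := eqVneq x 0; first by rewrite nrm0 mulr0 nrm_ge0.
  rewrite -(ler_pM2r nx) (le_trans _ (rdot_le _ _))//.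
  rewrite rdotBl rdotZl -nrm_sq -mulrA -expr2 mulNr lerDr.
  by have := pA x; rewrite lecE => /andP[].
exists (t - M) => [|x]; first by rewrite subr_gt0.
have := le_nrmD (t%:C *: x - A x) (A x); rewrite subrK nrmB nrmZr.
rewrite (ger0_norm (ltW (lt_trans M0 ht))) mulrBl lerBlDr => /le_trans; apply.
by rewrite lerD2l.
Qed.

Lemma op_horner_le (p : {poly R}) e x : 0 <= e ->
  (forall t, 0 <= t <= M -> `|p.[t]| <= e) -> nrm (op_horner A p x) <= e * nrm x.
Proof.
move=> e0 pe; apply: (op_horner_nrm lA sA (ltW M0)) => // t.
by move=> /approximate_eigenvalue_ge0_le /pe.
Qed.

(** Approximation takes place on all of [0, M], because the spectrum is located there only
    afterwards, by means of this very lemma. *)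
Lemma calculus_exists f (B : R) : (forall t, 0 <= t <= M -> `|f t| <= B) ->
  uniformly_continuous_upto M f -> exists T (p : nat -> {poly R}),
  [/\ bounded_operator T,
     forall n t, 0 <= t <= M -> `|(p n).[t] - f t| <= n.+1%:R^-1 &
     forall n x, nrm (op_horner A (p n) x - T x) <= n.+1%:R^-1 * nrm x].
Proof.
move=> fB uf; have [p pf] := weierstrass_seq M0 fB uf.
have [||T lT pT] := @op_cauchy_cvg (fun n => op_horner A (p n)).
- by move=> n; apply: op_horner_linear.
- move=> n m x; rewrite -op_hornerB//; apply: op_horner_le; first by rewrite addr_ge0.
  move=> t t0M; rewrite hornerD hornerN.
  have -> : (p n).[t] - (p m).[t] = ((p n).[t] - f t) - ((p m).[t] - f t) by ring.
  by rewrite (le_trans (ler_normB _ _))// lerD// pf.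
exists T, p; split=> //; apply/bounded_operatorP; split=> //.
have [L L0 pL] := op_horner_bound lA (p 0%N) (ltW M0) AM.
exists (L + 1) => [|x]; first by rewrite addr_ge0.
have -> : T x = op_horner A (p 0%N) x - (op_horner A (p 0%N) x - T x) by rewrite subKr.
rewrite (le_trans (le_nrmB _ _))// mulrDl lerD// (le_trans (pT _ _))//.
by rewrite invr1.
Qed.

(* For t outside [0, M] the inverse of A - t is the calculus of 1/(v - t). *)
Lemma spectrum_ge0_le t : spectrum A t%:C -> 0 <= t <= M.
Proof.
move=> At; apply: contrapT => /negP tM.
have [d d0 hd] : exists2 d : R, 0 < d & forall v : R, 0 <= v <= M -> d <= `|v - t|.
  move: tM; rewrite negb_and -!ltNge => /orP[t0|tM].
    exists (- t) => [|v /andP[v0 _]]; first by rewrite oppr_gt0.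
    by rewrite (le_trans _ (ler_norm _))// lerDr.
  exists (t - M) => [|v /andP[_ vM]]; first by rewrite subr_gt0.
  by rewrite distrC (le_trans _ (ler_norm _))// lerD2l lerN2.
have vt (v : R) : 0 <= v <= M -> v - t != 0 by move=> /hd vt; rewrite -normr_gt0 (lt_le_trans d0).
pose f v := (v - t)^-1.
have fB (v : R) : 0 <= v <= M -> `|f v| <= d^-1.
  by move=> vM; rewrite /f normfV lef_pV2 ?posrE ?normr_gt0 ?vt// hd.
have uf : uniformly_continuous_upto M f.
  move=> e e0; exists (e * d ^+ 2) => [|v w vM wM vw].
    by rewrite mulr_gt0// exprn_gt0.
  have -> : f v - f w = (w - v) * (f v * f w).
    by rewrite /f; field; rewrite !vt.
  rewrite normrM distrC (le_lt_trans (_ : _ <= `|v - w| * d ^- 2))//.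
    by rewrite ler_wpM2l// normrM expr2 invfM ler_pM ?fB.
  by rewrite ltr_pdivrMr// exprn_gt0.
have [T [p [bT pf pT]]] := calculus_exists fB uf.
have [lT _] := bT.
pose Q x := A x - t%:C *: x.
have QE : Q = op_horner A ('X - t%:P).
  by apply/funext => x; rewrite op_hornerB// op_hornerX// op_hornerC.
have lQ : linear Q by rewrite QE; apply: op_horner_linear.
pose D := M + `|t|.
have D0 : 0 <= D by rewrite addr_ge0// ltW.
have vD (v : R) : 0 <= v <= M -> `|v - t| <= D.
  move=> /andP[v0 vM]; rewrite (le_trans (ler_normB _ _))// lerD2r.
  by rewrite ger0_norm.
have QD x : nrm (Q x) <= D * nrm x.
  rewrite QE; apply: op_horner_le => // v vM.
  by rewrite hornerD hornerN hornerX hornerC vD.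
(* p_n(v) (v - t) - 1 = (p_n(v) - f(v)) (v - t) is uniformly small, so [T] inverts [Q] on both sides
   in the limit. *)
have pQ n x : nrm (op_horner A (p n * ('X - t%:P) - 1%:P) x) <= n.+1%:R^-1 * D * nrm x.
  apply: op_horner_le => [|v vM]; first by rewrite mulr_ge0.
  rewrite hornerD hornerN hornerC hornerM hornerD hornerN hornerX hornerC.
  have -> : (p n).[v] * (v - t) - 1 = ((p n).[v] - f v) * (v - t).
    by rewrite mulrBl /f mulVf// vt.
  by rewrite normrM ler_pM ?pf// vD.
apply: At; exists T; split=> // x; apply/eqP; rewrite -subr_eq0; apply/eqP/nrm_eq0/eqP;
  rewrite eq_le nrm_ge0 andbT; apply: (@le0_of_natSinv _ _ (D * nrm x + D * nrm x)) => n.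
- have -> : T (Q x) - x = op_horner A (p n * ('X - t%:P) - 1%:P) x
      - (op_horner A (p n) (Q x) - T (Q x)).
    by rewrite op_hornerB// op_hornerM// -QE op_hornerC scale1r opprB [RHS]addrC subrKA.
  rewrite (le_trans (le_nrmB _ _))// [leRHS]mulrDr lerD// ?mulrA ?pQ//.
  by rewrite (le_trans (pT _ _))// -mulrA ler_wpM2l.
- rewrite -[_ - x]/(Q (T x) - x).
  have -> : Q (T x) - x = op_horner A (p n * ('X - t%:P) - 1%:P) x
      - Q (op_horner A (p n) x - T x).
    rewrite [p n * _]mulrC op_hornerB// op_hornerM// -QE op_hornerC scale1r (linB lQ).
    by rewrite opprB [RHS]addrC subrKA.
  rewrite (le_trans (le_nrmB _ _))// [leRHS]mulrDr lerD// ?mulrA ?pQ//.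
  by rewrite (le_trans (QD _))// [n.+1%:R^-1 * D]mulrC -mulrA ler_wpM2l.
Qed.

Lemma is_cfc_powR s : 0 <= s -> exists T, is_cfc A (fun t => t `^ s) T.
Proof.
move=> s0.
have fB (v : R) : 0 <= v <= M -> `|v `^ s| <= M `^ s.
  move=> /andP[v0 vM]; rewrite ger0_norm ?powR_ge0// ge0_ler_powR ?nnegrE//.
  exact: ltW.
have [T [p [bT pf pT]]] := calculus_exists fB (powR_uniformly_continuous s0 (ltW M0)).
exists T; split=> //; exists p; split.
  apply/uniform_cvgP => e e0; near=> n => t /= /spectrum_ge0_le /pf.
  move=> /(_ n) /le_trans; apply; apply: ltW.
  near: n; exact: near_infty_natSinv_lt (PosNum e0).
apply/cvgrPdist_le => e e0; near=> n.
rewrite sub0r normrN ger0_norm ?op_norm_ge0//.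
rewrite (le_trans (op_norm_le (_ : 0 <= n.+1%:R^-1) _))//; first exact: pT.
apply: ltW; near: n; exact: near_infty_natSinv_lt (PosNum e0).
Unshelve. all: by end_near.
Qed.

Lemma op_pow_is_cfc s : 0 <= s -> is_cfc A (fun t => t `^ s) (op_pow A s).
Proof. by move=> s0; exact: (xgetPex 0 (is_cfc_powR s0)). Qed.

(** The gateway from [is_cfc] to polynomials: a single [p] is close to [f] where [op_horner_ge0]
    tests signs, and p(A) is close to [T]. *)
Lemma is_cfc_approx f T e : is_cfc A f T -> 0 < e -> exists p : {poly R},
  (forall t, approximate_eigenvalue A t -> `|p.[t] - f t| <= e) /\
  (forall x, nrm (op_horner A p x - T x) <= e * nrm x).
Proof.
move=> [bT [p [pf pT]]] e0.
have pf' : \forall n \near \oo, forall t, spectrum A t%:C -> `|(p n).[t] - f t| <= e.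
  by move: pf => /uniform_cvgP/(_ _ e0).
have /cvgrPdist_le/(_ _ e0) pT' := pT.
have [n [/= pfn pTn]] := filter_ex (filterI pf' pT').
exists (p n); split=> [t /(approximate_eigenvalue_spectrum)|x]; first exact: pfn.
have bpT : bounded_operator (op_horner A (p n) - T).
  have /bounded_operatorP [lT [K K0 TK]] := bT.
  have [L L0 pL] := op_horner_bound lA (p n) (ltW M0) AM.
  apply/bounded_operatorP; split; last first.
    exists (L + K) => [|y]; first exact: addr_ge0.
    by rewrite (le_trans (le_nrmB _ _))// mulrDl lerD.
  move=> a u w; rewrite /GRing.add /= /GRing.opp /= lT op_horner_linear//.
  by rewrite scalerBr opprD addrACA.
rewrite (le_trans (op_normP x bpT))// ler_wpM2r ?nrm_ge0//.
by move: pTn; rewrite sub0r normrN ger0_norm// op_norm_ge0.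
Qed.

End PositiveOperator.
End FunctionalCalculus.

(** * McCarthy's inequality *)

Section PowerInequalities.
Context {R : realType}.
Implicit Types (a b c g h r s t u x : R).

(** Young's inequality for the conjugate exponents 1 / t and 1 / (1 - t), with the endpoints done by
    hand. *)
Lemma powR_amgm a b t : 0 <= a -> 0 <= b -> 0 <= t <= 1 ->
  a `^ t * b `^ (1 - t) <= t * a + (1 - t) * b.
Proof.
move=> a0 b0 /andP[t0 t1].
have [->|tn0] := eqVneq t 0; first by rewrite powRr0 subr0 powRr1// !mul1r mul0r add0r.
have [->|tn1] := eqVneq t 1; first by rewrite powRr1// subrr powRr0 mulr1 mul1r mul0r addr0.
have tp : 0 < t by rewrite lt_neqAle eq_sym tn0.
have up : 0 < 1 - t by rewrite subr_gt0 lt_neqAle tn1.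
have := @conjugate_powR R (a `^ t) (b `^ (1 - t)) t^-1 (1 - t)^-1 (powR_ge0 _ _) (powR_ge0 _ _).
rewrite !invr_gt0 !invrK => /(_ tp up); rewrite [t + _]addrC subrK => /(_ erefl).
by rewrite -!powRrM !mulfV ?gt_eqF// !powRr1// [a * t]mulrC [b * _]mulrC.
Qed.

(** Weighted AM-GM with weight 1 / r yields the tangent-line bound for x^r at the midpoint m;
    summing it at g and h cancels the linear part. *)
Lemma powR_midpoint g h r : 0 < g -> 0 < h -> 1 <= r ->
  ((g + h) / 2) `^ r <= (g `^ r + h `^ r) / 2.
Proof.
move=> g0 h0 r1; set m := (g + h) / 2.
have m0 : 0 < m by rewrite divr_gt0// addr_gt0.
have r0 : 0 < r by exact: lt_le_trans r1.
have tangent x : 0 < x -> x * m `^ (r - 1) <= r^-1 * x `^ r + (1 - r^-1) * m `^ r.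
  move=> x0; have := @powR_amgm (x `^ r) (m `^ r) r^-1 (powR_ge0 _ _) (powR_ge0 _ _).
  rewrite invr_ge0 (ltW r0) invf_le1// r1 => /(_ isT); apply: le_trans.
  rewrite -!powRrM mulfV ?gt_eqF// powRr1 ?(ltW x0)// mulrBr mulr1 mulfV ?gt_eqF//.
have := lerD (tangent g g0) (tangent h h0).
rewrite -mulrDl; have -> : g + h = 2 * m by rewrite /m; field.
rewrite -mulrA mulr_powRB1 ?(ltW m0)// => H.
have : 2 * m `^ r * r^-1 <= (g `^ r + h `^ r) * r^-1 by lra.
rewrite ler_pM2r ?invr_gt0//; lra.
Qed.

(** AM-GM bounds the r-th powers of the two products by weighted means of a and b with swapped
    weights, and these add up to a + b. *)
Lemma heinz_powR (a b x u1 v1 u2 v2 alpha r : R) :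
  0 < a -> 0 < b -> 0 <= x -> 1 <= r -> 0 <= alpha <= 1 ->
  0 <= u1 <= a `^ (alpha / r) -> 0 <= v1 <= b `^ ((1 - alpha) / r) ->
  0 <= u2 <= a `^ ((1 - alpha) / r) -> 0 <= v2 <= b `^ (alpha / r) ->
  (x * ((u1 * v1 + u2 * v2) / 2)) `^ r <= x `^ r / 2 * (a + b).
Proof.
move=> a0 b0 x0 r1 /andP[al0 al1] /andP[u10 u1a] /andP[v10 v1b] /andP[u20 u2a] /andP[v20 v2b].
have r0 : 0 < r by exact: lt_le_trans r1.
pose g := a `^ (alpha / r) * b `^ ((1 - alpha) / r).
pose h := a `^ ((1 - alpha) / r) * b `^ (alpha / r).
have g0 : 0 < g by rewrite mulr_gt0 ?powR_gt0.
have h0 : 0 < h by rewrite mulr_gt0 ?powR_gt0.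
have gr : g `^ r <= alpha * a + (1 - alpha) * b.
  rewrite powRM ?powR_ge0// -!powRrM !divfK ?gt_eqF//.
  by apply: powR_amgm; [exact: ltW|exact: ltW|exact/andP].
have hr : h `^ r <= alpha * b + (1 - alpha) * a.
  rewrite powRM ?powR_ge0// -!powRrM !divfK ?gt_eqF// [leLHS]mulrC.
  by apply: powR_amgm; [exact: ltW|exact: ltW|exact/andP].
apply: (@le_trans _ _ ((x * ((g + h) / 2)) `^ r)).
  apply: ge0_ler_powR; rewrite ?nnegrE ?(ltW r0)//.
  - by rewrite mulr_ge0// divr_ge0// addr_ge0// mulr_ge0.
  - by rewrite mulr_ge0// divr_ge0// addr_ge0// ltW.
  - by rewrite ler_wpM2l// ler_wpM2r ?invr_ge0// lerD// ler_pM.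
rewrite powRM//; last by rewrite divr_ge0// addr_ge0// ltW.
rewrite -mulrA ler_wpM2l ?powR_ge0// (le_trans (powR_midpoint g0 h0 r1))//.
rewrite mulrC ler_wpM2l ?invr_ge0//.
have -> : a + b = alpha * a + (1 - alpha) * b + (alpha * b + (1 - alpha) * a) by ring.
exact: lerD.
Qed.

End PowerInequalities.

(** * Symmetry, positivity and McCarthy's bound for the calculus *)

Section CalculusOrder.
Context {R : realType} {Omega : Type} {H : functional_hilbert R Omega}.
Implicit Types (x y k : H) (S T : H -> H) (s t e c r v : R) (f : R -> R).

Local Notation "''[' u , v ]" := (fh_dot H u v) : ring_scope.

Lemma Re_normD (a b : R[i]) : complex.Re `|a + b| <= complex.Re `|a| + complex.Re `|b|.
Proof. by have := ler_normD a b; rewrite lecE raddfD => /andP[]. Qed.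

Lemma Re_norm_ge0 (a : R[i]) : 0 <= complex.Re `|a|.
Proof. by rewrite -ler0c ReK. Qed.

Lemma Re_norm_realM (a : R) (z : R[i]) : complex.Re `|a%:C * z| = `|a| * complex.Re `|z|.
Proof.
rewrite normrM [`|a%:C|]normc_def /= expr0n /= addr0 sqrtr_sqr.
by case: `|z| => u w /=; rewrite mul0r subr0.
Qed.

Variables (A : H -> H) (M : R).
Hypotheses (lA : linear A) (pA : positive_operator A) (M0 : 0 < M) (AM : op_bound A M).

Let sA : symmetric_operator A := positive_symmetric lA pA.

Lemma is_cfc_symmetric f T : is_cfc A f T -> symmetric_operator T.
Proof.
move=> fT x y; apply/eqP; rewrite -subr_eq0 -normr_eq0 -[X in X == 0]ReK//.
rewrite -[0]/(0%:C) (inj_eq (@complexI R)) eq_le Re_norm_ge0 andbT.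
apply: (@le0_of_small _ _ (nrm x * nrm y + nrm x * nrm y)) => e /andP[e0 _].
have [p [_ pT]] := is_cfc_approx lA M0 AM fT e0.
have -> : '[T x, y] - '[x, T y] =
    '[T x - op_horner A p x, y] + '[x, op_horner A p y - T y].
  by rewrite dotBl dotBr (op_horner_symmetric lA p sA) addrA subrK.
rewrite (le_trans (Re_normD _ _))// mulrDr lerD// (le_trans (cauchy_schwarz _ _))//.
  by rewrite nrmB mulrA ler_wpM2r ?nrm_ge0.
by rewrite mulrCA ler_wpM2l ?nrm_ge0.
Qed.

Lemma is_cfc_ge0 f T x : is_cfc A f T -> (forall t, 0 <= t <= M -> 0 <= f t) ->
  0 <= rdot (T x) x.
Proof.
move=> fT f0; rewrite -oppr_le0.
apply: (@le0_of_small _ _ (nrm x ^+ 2 + nrm x ^+ 2)) => e /andP[e0 _].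
have [p [pf pT]] := is_cfc_approx lA M0 AM fT e0.
have := @op_horner_ge0 _ _ _ A M lA sA (ltW M0) AM (p + e%:P) x.
have := abs_rdot_le (op_horner A p x - T x) x.
rewrite rdotBl op_hornerD// op_hornerC rdotDl rdotZl -nrm_sq => /ler_normlP[_ h1] h2.
have {h2} : 0 <= rdot (op_horner A p x) x + e * nrm x ^+ 2.
  apply: h2 => t At; have := pf _ At; rewrite hornerD hornerC => /ler_normlP[h2 _].
  have := f0 _ (approximate_eigenvalue_ge0_le pA M0 AM At); lra.
have := ler_wpM2r (nrm_ge0 x) (pT x); rewrite -mulrA -expr2; lra.
Qed.

(* For every c > 0, concavity gives
   v^(2s) <= c^theta (theta v^r / c + 1 - theta) with theta = 2s/r, and the
   functional calculus preserves this inequality. *)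
Lemma is_cfc_powR_le s r c S T k : 0 <= s -> 0 < r -> 2 * s <= r ->
  is_cfc A (fun t => t `^ s) T -> is_cfc A (fun t => t `^ r) S ->
  nrm k = 1 -> 0 < c -> rdot (S k) k <= c -> nrm (T k) <= c `^ (s / r).
Proof.
move=> s0 r0 sr sT rS k1 c0 Sc.
pose th := 2 * s / r.
have th0 : 0 <= th by rewrite divr_ge0 ?mulr_ge0// ltW.
have th1 : th <= 1 by rewrite ler_pdivrMr// mul1r.
have cth : (c `^ (s / r)) ^+ 2 = c `^ th.
  by rewrite -powR_mulrn ?powR_ge0// -powRrM /th mulrC mulrA.
rewrite -(@ler_pXn2r _ 2)// ?nnegrE ?nrm_ge0 ?powR_ge0// cth.
(* Slope and intercept of the tangent to u^th at u = c, where u stands for v^r; hence a c + b =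
   c^th. *)
pose a := c `^ th * th / c; pose b := c `^ th * (1 - th).
have a0 : 0 <= a by rewrite !mulr_ge0 ?powR_ge0 ?invr_ge0// ltW.
have ab (v : R) : 0 <= v -> (v `^ s) ^+ 2 <= a * v `^ r + b.
  move=> v0; have -> : (v `^ s) ^+ 2 = c `^ th * (v `^ r / c) `^ th.
    rewrite -powR_mulrn ?powR_ge0// -powRrM -powRM ?(ltW c0) ?divr_ge0 ?powR_ge0 ?(ltW c0)//.
    rewrite [c * _]mulrC divfK ?gt_eqF// -powRrM /th; congr (_ `^ _).
    by field; rewrite gt_eqF.
  have := @powR_amgm R (v `^ r / c) 1 th; rewrite th0 th1 powR1 mulr1.
  move=> /(_ _ ler01 isT); rewrite divr_ge0 ?powR_ge0 ?(ltW c0)// => /(_ isT).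
  move=> /(ler_wpM2l (powR_ge0 c th)) /le_trans; apply.
  by rewrite /a /b; lra.
suff h : nrm (T k) ^+ 2 <= a * rdot (S k) k + b.
  rewrite (le_trans h)// (le_trans (_ : _ <= a * c + b))//.
    by rewrite lerD2r ler_wpM2l.
  by rewrite /a /b divfK ?gt_eqF//; lra.
rewrite -subr_le0.
(* Error budget: 2 M^s + 1 for p^2 against t^(2s), one a for q against t^r, one a for q(A) against
   [S], the rest for |T k|^2 against |p(A) k|^2. *)
pose C := 2 * M `^ s + 1 + a + a + (2 * (nrm (T k) + 1) + 1).
apply: (@le0_of_small _ _ C) => e /andP[e0 e1].
have [p [ps pT]] := is_cfc_approx lA M0 AM sT e0.
have [q [qr qS]] := is_cfc_approx lA M0 AM rS e0.
have := @op_horner_ge0 _ _ _ A M lA sA (ltW M0) AM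
  (a *: q + (b + (2 * M `^ s + 1 + a) * e)%:P - p * p) k.
rewrite op_hornerB// op_hornerD// op_hornerZ// op_hornerC// op_hornerM//.
rewrite rdotBl rdotDl !rdotZl (symmetric_rdot _ _ (op_horner_symmetric lA p sA)) -!nrm_sq k1.
rewrite expr1n mulr1 => hpq.
have {hpq} h1 : nrm (op_horner A p k) ^+ 2 <=
    a * rdot (op_horner A q k) k + (b + (2 * M `^ s + 1 + a) * e).
  rewrite -subr_ge0; apply: hpq => t At.
  have tM := approximate_eigenvalue_ge0_le pA M0 AM At.
  have [t0 tM'] := andP tM.
  rewrite hornerD hornerN hornerD hornerZ hornerC hornerM.
  have := ab _ t0; have /ler_normlP[p1 p2] := ps _ At; have /ler_normlP[q1 q2] := qr _ At.
  have tsM : t `^ s <= M `^ s by rewrite ge0_ler_powR ?nnegrE// ltW.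
  have ts0 := powR_ge0 t s.
  have pp : p.[t] * p.[t] <= (t `^ s) ^+ 2 + (2 * M `^ s + 1) * e.
    have : `|p.[t]| <= t `^ s + e by apply/ler_normlP; split; lra.
    move=> /(lerXn2r 2 (_ : `|p.[t]| \in Num.nneg)) h.
    have {h} : p.[t] ^+ 2 <= (t `^ s + e) ^+ 2.
      by rewrite -[leLHS]real_normK ?num_real//; apply: h; rewrite nnegrE// addr_ge0// ltW.
    rewrite -expr2; nra.
  have aq : a * t `^ r - a * e <= a * q.[t] by rewrite -mulrBr ler_wpM2l//; lra.
  lra.
have h2 : rdot (op_horner A q k) k <= rdot (S k) k + e.
  have := rdot_le (op_horner A q k - S k) k; rewrite rdotBl k1 mulr1.
  have := qS k; rewrite k1 mulr1; lra.
have h3 : nrm (T k) <= nrm (op_horner A p k) + e.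
  have := le_nrmB (op_horner A p k) (op_horner A p k - T k); rewrite subKr.
  have := pT k; rewrite k1 mulr1; lra.
have h4 : nrm (op_horner A p k) <= nrm (T k) + e.
  have := le_nrmD (op_horner A p k - T k) (T k); rewrite subrK.
  have := pT k; rewrite k1 mulr1; lra.
have h5 : nrm (T k) ^+ 2 <= nrm (op_horner A p k) ^+ 2 + (2 * (nrm (T k) + 1) + 1) * e.
  have := nrm_ge0 (T k); have := nrm_ge0 (op_horner A p k); nra.
have h6 := ler_wpM2l a0 h2.
rewrite /C; lra.
Qed.

End CalculusOrder.

(** * Bounds for the supremum defining the Berezin number *)

Section BerezinNumber.
Context {R : realType} {Omega : Type} {H : functional_hilbert R Omega}.
Implicit Types (T : H -> H) (lam : Omega).

Local Notation "''[' u , v ]" := (fh_dot H u v) : ring_scope.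

Lemma nrm_normalized_kernel lam : reproducing_kernel lam != 0 :> H ->
  nrm (normalized_kernel lam : H) = 1.
Proof.
move=> /nrm_gt0 k0; rewrite nrmZ nrmE -(fmorphV (real_complex R)) normc_def /=.
by rewrite expr0n addr0 sqrtr_sqr ger0_norm ?invr_ge0 ?nrm_ge0// mulVf// gt_eqF.
Qed.

Lemma ber_le T (C : R) : inhabited Omega ->
  (forall lam, complex.Re `|'[T (normalized_kernel lam), normalized_kernel lam]| <= C) ->
  ber T <= C.
Proof.
move=> [lam0] TC; apply: ge_sup; last by move=> _ [lam _ <-].
by exists (complex.Re `|'[T (normalized_kernel lam0), normalized_kernel lam0]|), lam0.
Qed.

Lemma le_ber T (C : R) lam0 :
  (forall lam, complex.Re `|'[T (normalized_kernel lam), normalized_kernel lam]| <= C) ->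
  complex.Re `|'[T (normalized_kernel lam0), normalized_kernel lam0]| <= ber T.
Proof.
by move=> TC; apply: ub_le_sup; [exists C => _ [lam _ <-]|exists lam0].
Qed.

Lemma le_ber_bounded T (C : R) lam0 : (forall lam, reproducing_kernel lam != 0 :> H) ->
  op_bound T C ->
  complex.Re `|'[T (normalized_kernel lam0), normalized_kernel lam0]| <= ber T.
Proof.
move=> k0 TC; apply: (@le_ber T C) => lam; rewrite (le_trans (cauchy_schwarz _ _))//.
by have := TC (normalized_kernel lam); rewrite nrm_normalized_kernel// !mulr1.
Qed.

Lemma op_boundD T1 T2 (C1 C2 : R) : op_bound T1 C1 -> op_bound T2 C2 ->
  op_bound (T1 + T2) (C1 + C2).
Proof. by move=> h1 h2 x; rewrite (le_trans (le_nrmD _ _))// mulrDl lerD. Qed.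

Lemma op_boundZ T (C a : R) : op_bound T C -> op_bound (a%:C *: T) (`|a| * C).
Proof. by move=> h x; rewrite nrmZr -mulrA ler_wpM2l. Qed.

End BerezinNumber.

(** * Berezin number inequalities *)

Section PositiveBounded.
Context {R : realType} {Omega : Type} {H : functional_hilbert R Omega}.

Local Notation "''[' u , v ]" := (fh_dot H u v) : ring_scope.

Variable A : H -> H.
Hypotheses (bA : bounded_operator A) (pA : positive_operator A).

Let pos_bound : linear A /\ exists2 M : R, 0 < M & op_bound A M.
Proof.
move: bA => /bounded_operatorP [lA [K K0 AK]]; split=> //.
exists (K + 1) => [|x]; first by rewrite ltr_wpDl.
by rewrite (le_trans (AK x))// ler_wpM2r ?nrm_ge0// lerDl.
Qed.

Lemma bounded_op_pow (s : R) : 0 <= s -> bounded_operator (op_pow A s).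
Proof. by have [lA [M M0 AM]] := pos_bound => /(op_pow_is_cfc lA pA M0 AM) []. Qed.

Lemma symmetric_op_pow (s : R) : 0 <= s -> symmetric_operator (op_pow A s).
Proof.
have [lA [M M0 AM]] := pos_bound => /(op_pow_is_cfc lA pA M0 AM).
exact: (is_cfc_symmetric lA pA M0 AM).
Qed.

Lemma op_pow_ge0 (s : R) (x : H) : 0 <= s -> 0 <= rdot (op_pow A s x) x.
Proof.
have [lA [M M0 AM]] := pos_bound => /(op_pow_is_cfc lA pA M0 AM) sA.
by apply: (is_cfc_ge0 lA pA M0 AM _ sA) => t _; exact: powR_ge0.
Qed.

Lemma nrm_op_pow_le (s r c : R) (k : H) : 0 <= s -> 0 < r -> 2 * s <= r -> nrm k = 1 ->
  0 < c -> rdot (op_pow A r k) k <= c -> nrm (op_pow A s k) <= c `^ (s / r).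
Proof.
have [lA [M M0 AM]] := pos_bound => s0 r0 sr.
have sT := op_pow_is_cfc lA pA M0 AM s0; have rS := op_pow_is_cfc lA pA M0 AM (ltW r0).
exact: (is_cfc_powR_le lA pA M0 AM s0 r0 sr sT rS).
Qed.

Lemma Re_dot_comp_le (S X T : H -> H) (k : H) : symmetric_operator S -> bounded_operator X ->
  complex.Re `|'[S (X (T k)), k]| <= op_norm X * (nrm (S k) * nrm (T k)).
Proof.
move=> sS bX; rewrite sS (le_trans (cauchy_schwarz _ _))//.
rewrite [nrm (S k) * _]mulrC mulrA ler_wpM2r ?nrm_ge0//; exact: op_normP.
Qed.

End PositiveBounded.

Theorem theorem2p11 (R : realType) (Omega : Type)
    (H : functional_hilbert R Omega)
    (Omega_nonempty : inhabited Omega)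
    (kernel_neq0 : forall lam : Omega, (reproducing_kernel lam : H) != 0)
    (A B X : H -> H)
    (hA : bounded_operator A) (hB : bounded_operator B)
    (hX : bounded_operator X)
    (posA : positive_operator A) (posB : positive_operator B)
    (r alpha : R) (hr : 2 <= r) (halpha0 : 0 <= alpha) (halpha1 : alpha <= 1) :
  ber ((2^-1 : R[i]) *:
       ((op_pow A alpha \o X \o op_pow B (1 - alpha))
        + (op_pow A (1 - alpha) \o X \o op_pow B alpha))) `^ r
    <= op_norm X `^ r / 2 * ber (op_pow A r + op_pow B r)
  /\
  op_norm X `^ r / 2 * ber (op_pow A r + op_pow B r)
    <= op_norm X `^ r / 2 *
       (ber (alpha%:C *: op_pow A r + (1 - alpha)%:C *: op_pow B r)
        + ber ((1 - alpha)%:C *: op_pow A r + alpha%:C *: op_pow B r)).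
Proof.
have bA := bounded_op_pow hA posA; have bB := bounded_op_pow hB posB.
have leA := nrm_op_pow_le hA posA; have leB := nrm_op_pow_le hB posB.
have al01 : 0 <= alpha <= 1 by rewrite halpha0.
have be0 : 0 <= 1 - alpha by rewrite subr_ge0.
have r0 : 0 < r by rewrite (lt_le_trans _ hr).
have r1 : 1 <= r by rewrite (le_trans _ hr)// ler1n.
have X0 : 0 <= op_norm X `^ r / 2 by rewrite divr_ge0 ?powR_ge0.
have /bounded_operatorP [_ [KA KA0 KAP]] := bA r (ltW r0).
have /bounded_operatorP [_ [KB KB0 KBP]] := bB r (ltW r0).
pose k lam : H := normalized_kernel lam.
have k1 lam : nrm (k lam) = 1 by exact: nrm_normalized_kernel.
have le_berAB lam : rdot (op_pow A r (k lam)) (k lam) + rdot (op_pow B r (k lam)) (k lam)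
    <= ber (op_pow A r + op_pow B r).
  apply: le_trans (le_ber_bounded lam kernel_neq0 (op_boundD KAP KBP)).
  by rewrite -rdotDl (le_trans (ler_norm _))// Re_le_norm.
have [lam0] := Omega_nonempty.
split; last first.
  apply: ler_wpM2l => //; apply: ber_le => // lam.
  have ubd (a b : R) := le_ber_bounded lam kernel_neq0
    (op_boundD (@op_boundZ _ _ _ _ _ a KAP) (@op_boundZ _ _ _ _ _ b KBP)).
  (* At each kernel the two weighted operators sum to A^r + B^r. *)
  apply: le_trans (lerD (ubd _ _) (ubd _ _)).
  apply: le_trans (Re_normD _ _); rewrite -dotDl.
  rewrite !fctE addrACA -!scalerDl -!(rmorphD (real_complex R)) /=.
  have e1 : alpha + (1 - alpha) = 1 by rewrite addrC subrK.
  by rewrite e1 subrK !scale1r.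
set T := (_ *: _).
set W := _ / 2 * ber _.
have val_le lam : complex.Re `|fh_dot H (T (k lam)) (k lam)| `^ r <= W.
  set a := rdot (op_pow A r (k lam)) (k lam).
  set b := rdot (op_pow B r (k lam)) (k lam).
  have a0 : 0 <= a by apply: op_pow_ge0 => //; exact: ltW.
  have b0 : 0 <= b by apply: op_pow_ge0 => //; exact: ltW.
  apply: (@le_trans _ _ (op_norm X `^ r / 2 * (a + b))); last first.
    by apply: ler_wpM2l => //; exact: le_berAB.
  rewrite -subr_le0.
  (* [a] or [b] may be 0 while [nrm_op_pow_le] asks for a positive bound; shifting both by [e] costs
     e |X|^r after the halving. *)
  apply: (@le0_of_small _ _ (op_norm X `^ r)) => e /andP[e0 _].
  rewrite lerBlDl.
  have ae : 0 < a + e by rewrite ltr_wpDl.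
  have be : 0 < b + e by rewrite ltr_wpDl.
  have al2 : 2 * alpha <= r by rewrite (le_trans _ hr)// ler_piMr.
  have be2 : 2 * (1 - alpha) <= r by rewrite (le_trans _ hr)// ler_piMr// gerBl.
  have le_ae : a <= a + e by rewrite lerDl ltW.
  have le_be : b <= b + e by rewrite lerDl ltW.
  have u1 := leA _ _ _ (k lam) halpha0 r0 al2 (k1 lam) ae le_ae.
  have v1 := leB _ _ _ (k lam) be0 r0 be2 (k1 lam) be le_be.
  have u2 := leA _ _ _ (k lam) be0 r0 be2 (k1 lam) ae le_ae.
  have v2 := leB _ _ _ (k lam) halpha0 r0 al2 (k1 lam) be le_be.
  have -> : op_norm X `^ r / 2 * (a + b) + e * op_norm X `^ r =
      op_norm X `^ r / 2 * ((a + e) + (b + e)) by field.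
  apply: le_trans (@heinz_powR _ _ _ _ _ _ _ _ _ _ ae be (op_norm_ge0 X) r1 al01
    (introT andP (conj (nrm_ge0 _) u1)) (introT andP (conj (nrm_ge0 _) v1))
    (introT andP (conj (nrm_ge0 _) u2)) (introT andP (conj (nrm_ge0 _) v2))).
  apply: ge0_ler_powR; rewrite ?nnegrE ?(ltW r0) ?Re_norm_ge0//.
    by rewrite mulr_ge0 ?op_norm_ge0// divr_ge0// addr_ge0// mulr_ge0 ?nrm_ge0.
  have bX S T' : symmetric_operator S ->
      complex.Re `|fh_dot H ((S \o X \o T') (k lam)) (k lam)| <=
      op_norm X * (nrm (S (k lam)) * nrm (T' (k lam))).
    by move=> symS; exact: (Re_dot_comp_le T' (k lam) symS hX).
  have -> : complex.Re `|fh_dot H (T (k lam)) (k lam)| = complex.Re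
      `|fh_dot H ((op_pow A alpha \o X \o op_pow B (1 - alpha)) (k lam)) (k lam) +
        fh_dot H ((op_pow A (1 - alpha) \o X \o op_pow B alpha) (k lam)) (k lam)| / 2.
    have h : (2^-1 : R[i]) = (2^-1 : R)%:C by rewrite (fmorphV (real_complex R)) rmorph_nat.
    have h2 : `|2^-1 : R| = 2^-1 by rewrite ger0_norm ?invr_ge0.
    rewrite /T h !fctE dotZl dotDl Re_norm_realM h2.
    by rewrite [LHS]mulrC.
  rewrite mulrA ler_wpM2r ?invr_ge0// (le_trans (Re_normD _ _))// mulrDr.
  by rewrite lerD// bX//; exact: symmetric_op_pow.
have W0 : 0 <= W by exact: le_trans (powR_ge0 _ _) (val_le lam0).
(* The power r sits outside the supremum, so the r-th root is taken pointwise before passing to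
   [ber]. *)
have val_le' lam : complex.Re `|fh_dot H (T (k lam)) (k lam)| <= W `^ r^-1.
  have := ge0_ler_powR (ltW (_ : 0 < r^-1)) _ _ (val_le lam).
  rewrite invr_gt0 !nnegrE powR_ge0 -powRrM mulfV ?gt_eqF// powRr1 ?Re_norm_ge0//.
  exact.
have -> : W = (W `^ r^-1) `^ r by rewrite -powRrM mulVf ?gt_eqF// powRr1.
apply: ge0_ler_powR; rewrite ?nnegrE ?(ltW r0) ?powR_ge0//; last exact: ber_le.
by rewrite (le_trans _ (le_ber lam0 val_le'))// Re_norm_ge0.
Qed.
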